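(* Let $A_1,A_2$ be rational functions of degree $m\ge2$. Then for any pair of positive integers $(d_1,d_2)$ there exist at most finitely many $(A_1,A_2)$-invariant curves of bi-degree $(d_1,d_2)$. Moreover, there exists a function $\gamma:\mathbb N\times\mathbb N\times\mathbb N\to\mathbb R$ (independent of $A_1,A_2,m,d_1,d_2$) such that the number of these curves does not exceed $\gamma(m,d_1,d_2)$.
   Context: Rational functions are nonconstant elements of $\mathbb C(z)$. The map $(A_1,A_2):(\mathbb P^1(\mathbb C))^2\to(\mathbb P^1(\mathbb C))^2$ is $(z_1,z_2)\mapsto(A_1(z_1),A_2(z_2))$. An $(A_1,A_2)$-invariant curve is an irreducible algebraic curve $\mathcal C$ in $(\mathbb P^1(\mathbb C))^2$ with $(A_1,A_2)(\mathcal C)=\mathcal C$. The bi-degree of a curve in $(\mathbb P^1(\mathbb C))^2$ is the pair of degrees, in the first and in the second variable respectively, of its reduced bihomogeneous defining equation. *)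

(* Defs.v *)
From mathcomp Require Import all_boot all_order all_algebra.
From mathcomp Require Import finmap boolp classical_sets functions cardinality.
From mathcomp Require Import reals.
From mathcomp Require Import complex mpoly.

Set Implicit Arguments.
Unset Strict Implicit.
Unset Printing Implicit Defensive.

Import Order.TTheory GRing.Theory Num.Theory.
Local Open Scope classical_set_scope.
Local Open Scope ring_scope.

(* The complex numbers are [R[i]] for [R : realType]. *)

(* The projective line as the Riemann sphere: [Some z] is the point [z : 1]
   and [None] is the point at infinity [1 : 0]. *)
Definition P1 (R : realType) : Type := option R[i].

Definition hcoord (R : realType) (x : P1 R) : 'rV[R[i]]_2 :=
  if x is Some z then row_mx z%:M (1%:M : 'M_1)
  else row_mx 1%:M (0 : 'M_1).

(* C(z) is the fraction field of C[z].  [rnum f] and [rden f] are the coprime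
   numerator and denominator of f (defined up to a common constant factor). *)
Definition rnum (R : realType) (f : {fraction {poly R[i]}}) : {poly R[i]} :=
  let r := repr f in \n_r %/ gcdp \n_r \d_r.

Definition rden (R : realType) (f : {fraction {poly R[i]}}) : {poly R[i]} :=
  let r := repr f in \d_r %/ gcdp \n_r \d_r.

Definition rdeg (R : realType) (f : {fraction {poly R[i]}}) : nat :=
  maxn (size (rnum f)).-1 (size (rden f)).-1.

(* The value at infinity is the limit of p / q: it is infinite when
   deg p > deg q, and otherwise it is the quotient of the coefficients of
   degree deg q (which is 0 when deg p < deg q). *)
Definition reval (R : realType) (f : {fraction {poly R[i]}}) (x : P1 R) : P1 R :=
  let p := rnum f in
  let q := rden f in
  if x is Some z then
    (if q.[z] == 0 then None else Some (p.[z] / q.[z]))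
  else
    (if (size q < size p)%N then None
     else Some (p`_(size q).-1 / lead_coef q)).

Definition rmap2 (R : realType) (A1 A2 : {fraction {poly R[i]}})
    (x : P1 R * P1 R) : P1 R * P1 R :=
  (reval A1 x.1, reval A2 x.2).

(* Variables 0 and 1 are the homogeneous coordinates of the first factor of
   P1 x P1, variables 2 and 3 those of the second factor. *)
Definition bihomogeneous (R : realType) (d1 d2 : nat)
    (F : {mpoly R[i][2 + 2]}) : Prop :=
  forall mon : 'X_{1.. 2 + 2}, mon \in msupp F ->
    (\sum_(i < 2) mon (lshift 2 i) = d1)%N /\
    (\sum_(i < 2) mon (rshift 2 i) = d2)%N.

(* The point x is a zero of F; for bihomogeneous F this does not depend on the
   choice of the homogeneous coordinates. *)
Definition vanishes_at (R : realType) (F : {mpoly R[i][2 + 2]})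
    (x : P1 R * P1 R) : Prop :=
  F.@[fun i => row_mx (hcoord x.1) (hcoord x.2) 0 i] = 0.

Definition zero_locus (R : realType) (F : {mpoly R[i][2 + 2]})
    : set (P1 R * P1 R) :=
  [set x | vanishes_at F x].

Definition zariski_closed (R : realType) (X : set (P1 R * P1 R)) : Prop :=
  exists S : set {mpoly R[i][2 + 2]},
    (forall F, S F -> exists e1 e2, bihomogeneous e1 e2 F) /\
    X = [set x | forall F, S F -> vanishes_at F x].

Definition zariski_irreducible (R : realType) (X : set (P1 R * P1 R)) : Prop :=
  X !=set0 /\
  forall Y Z : set (P1 R * P1 R), zariski_closed Y -> zariski_closed Z ->
    X `<=` Y `|` Z -> X `<=` Y \/ X `<=` Z.

Definition algebraic_curve (R : realType) (X : set (P1 R * P1 R)) : Prop :=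
  exists (e1 e2 : nat) (F : {mpoly R[i][2 + 2]}),
    [/\ (0 < e1 + e2)%N, F != 0, bihomogeneous e1 e2 F & X = zero_locus F].

Definition reduced_mpoly (R : realType) (F : {mpoly R[i][2 + 2]}) : Prop :=
  F != 0 /\
  forall G H : {mpoly R[i][2 + 2]}, F = G ^+ 2 * H -> G \is a GRing.unit.

Definition has_bidegree (R : realType) (d1 d2 : nat)
    (X : set (P1 R * P1 R)) : Prop :=
  exists F : {mpoly R[i][2 + 2]},
    [/\ bihomogeneous d1 d2 F, reduced_mpoly F & X = zero_locus F].

Definition invariant_curve (R : realType) (A1 A2 : {fraction {poly R[i]}})
    (X : set (P1 R * P1 R)) : Prop :=
  [/\ algebraic_curve X, zariski_irreducible X & rmap2 A1 A2 @` X = X].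

Definition invariant_curves (R : realType) (A1 A2 : {fraction {poly R[i]}})
    (d1 d2 : nat) : set (set (P1 R * P1 R)) :=
  [set X | invariant_curve A1 A2 X /\ has_bidegree d1 d2 X].

(* Main.v *)
Require Import Defs.
From mathcomp Require Import all_boot all_order all_algebra.
From mathcomp Require Import finmap boolp classical_sets functions cardinality.
From mathcomp Require Import reals complex mpoly.
From mathcomp Require Import zify ring.
Import Order.TTheory GRing.Theory Num.Theory.
Local Open Scope ring_scope.
Set Implicit Arguments.
Unset Strict Implicit.
Unset Printing Implicit Defensive.

(** Throughout, X is an invariant curve given by a form of bidegree (d1, d2)
    over the algebraically closed field C, and N is a number depending only on
    d1 and d2.  The count rests on three facts.

    Few intersections determine the curve.  Let X and X' be zero loci of
    forms V and F.  If they have common points over n+1 values of the first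
    coordinate, where n is the intersection number of the bidegrees, then
    counting unknowns against linear conditions produces a relation S V = T F
    with T nonzero of smaller degree in the second variable than V
    ([elimination]).  Since X is irreducible and contained in the zero locus of
    T F, it lies in X' or in the zero locus of T, and one repeats the argument
    with T in place of V.  In degree 0 this must stop, because X projects onto
    the first factor ([subset_zform]).  Hence X is contained in X' as soon as
    the two curves meet over N given values z_1, ..., z_N of the first
    coordinate.

    There are enough preperiodic points.  A rational function of degree at least
    2 has a fixed point z0 with a second preimage: otherwise all fixed points are
    totally ramified, which gives three m-th powers of linear forms with a linear
    relation that cannot hold ([ratmap_fixpoint]).  The set of k-th preimages of
    such a z0 grows strictly with k, so it has at least k+1 elements
    ([ratmap_backward_orbit]).  Take z_1, ..., z_N among the finite N-th
    preimages of z0 under A1.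

    The points of X over z_i take boundedly many values.  The fibre of X over z0
    is finite with at most d2+1 elements, since an irreducible X that projects
    onto the first factor contains no vertical line ([curve_fiber_finite]), and
    A2 maps this fibre into itself.  Therefore the N-th iterate of A2 sends the
    second coordinate of every point of X over z_i to a preperiodic point of A2 of
    bounded preperiod and period.  There are boundedly many such points
    ([ratmap_preperiodic]), because the equation for the periodic points is a
    nonzero polynomial of bounded degree.

    Choosing a point of X over each z_i thus maps invariant curves injectively to
    a finite set whose size depends on m, d1 and d2 only
    ([stable_curves_injection]).  The reducedness of the defining form is used
    only through the fact that the form is nonzero. *)

(** * Binary forms on the projective line *)

Section ProjectiveLine.
Variable C : numClosedFieldType.
Implicit Types (p q : {poly C}) (x : option C) (n m : nat).

(** A point of the projective line is [Some z] or the point at infinity [None].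
    [hval n p x] is the value at the normalised homogeneous coordinates of [x],
    that is (z, 1) or (1, 0), of the binary form of degree [n] obtained by
    homogenising [p]; it is meaningful when [p] has degree at most [n]. *)
Definition hval n p x : C := if x is Some z then p.[z] else p`_n.

Lemma hval0 n x : hval n 0 x = 0.
Proof. by case: x => [z|]; rewrite /hval ?horner0 ?coef0. Qed.

Lemma hvalD n p q x : hval n (p + q) x = hval n p x + hval n q x.
Proof. by case: x => [z|]; rewrite /hval ?hornerD ?coefD. Qed.

Lemma hvalZ n c p x : hval n (c *: p) x = c * hval n p x.
Proof. by case: x => [z|]; rewrite /hval ?hornerZ ?coefZ. Qed.

Lemma hvalB n p q x : hval n (p - q) x = hval n p x - hval n q x.
Proof. by rewrite hvalD -scaleN1r hvalZ mulN1r. Qed.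

Lemma hval_sum n (I : Type) (r : seq I) (P : pred I) (F : I -> {poly C}) x :
  hval n (\sum_(i <- r | P i) F i) x = \sum_(i <- r | P i) hval n (F i) x.
Proof.
by apply: (big_morph (fun p => hval n p x)); [move=> ? ?; exact: hvalD|exact: hval0].
Qed.

Lemma coefM_top n m p q : (size p <= n.+1)%N -> (size q <= m.+1)%N ->
  (p * q)`_(n + m) = p`_n * q`_m.
Proof.
move=> sp sq; rewrite coefM.
have ln : (n < (n + m).+1)%N by rewrite ltnS leq_addr.
rewrite (bigD1 (Ordinal ln)) //= addKn big1 ?addr0 // => i /eqP ni.
have [le_in|lt_ni] := leqP i n; last by rewrite (nth_default _ (leq_trans sp lt_ni)) mul0r.
rewrite [q`__]nth_default ?mulr0 //; apply: (leq_trans sq).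
have lt_in : (i < n)%N.
  by rewrite ltn_neqAle le_in andbT; apply/eqP => e; apply: ni; apply: val_inj.
by rewrite ltn_subRL ltn_add2r.
Qed.

Lemma hvalM n m p q x : (size p <= n.+1)%N -> (size q <= m.+1)%N ->
  hval (n + m) (p * q) x = hval n p x * hval m q x.
Proof. by case: x => [z|] sp sq; rewrite /hval ?hornerM ?coefM_top. Qed.

Lemma size_leS_top n p : (size p <= n.+1)%N -> p`_n = 0 -> (size p <= n)%N.
Proof.
move=> sp pn; rewrite leqNgt; apply/negP => ltn.
have es : size p = n.+1 by apply/eqP; rewrite eqn_leq sp ltn.
have : lead_coef p == 0 by rewrite lead_coefE es pn.
by rewrite lead_coef_eq0 -size_poly_eq0 es.
Qed.

Lemma hval_root n p : (0 < n)%N -> (size p <= n.+1)%N -> exists x, hval n p x = 0.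
Proof.
move=> n0 sp; have [pn|pn] := eqVneq p`_n 0; first by exists None.
have [|z /rootP rz] := @closed_rootP _ p _; last by exists (Some z).
apply: contra_neq pn => /eqP; rewrite eqn_leq => /andP[s1 _].
by rewrite nth_default // (leq_trans s1).
Qed.

Lemma hval_zeros n p : p != 0 -> (size p <= n.+1)%N ->
  exists2 s : seq (option C), (size s <= n.+1)%N & forall x, hval n p x = 0 -> x \in s.
Proof.
move=> p0 sp; have [r er] := closed_field_poly_normal p.
exists (None :: map some r) => [|[z|] //= ez]; last first.
  rewrite inE /= mem_map; last exact: Some_inj.
  move/eqP: ez; rewrite -[_ == 0]/(root p z) er rootZ ?lead_coef_eq0 //.
  by rewrite root_prod_XsubC.
rewrite /= size_map (leq_trans _ sp) //.
by rewrite er size_scale ?lead_coef_eq0 // size_prod_XsubC.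
Qed.

End ProjectiveLine.

(** * Rational maps of the projective line *)

Section RationalMaps.
Variable C : numClosedFieldType.
Implicit Types (p q : {poly C}) (x y : option C) (n m : nat).

(** [f] is the map x |-> p(x) / q(x) of the projective line, where [p] and [q]
    are binary forms of degree [m] without a common zero. *)
Definition ratmap m p q (f : option C -> option C) : Prop :=
  [/\ (size p <= m.+1)%N, (size q <= m.+1)%N,
      forall x, hval m p x = 0 -> hval m q x != 0
    & forall x, f x = if hval m q x == 0 then None
                      else Some (hval m p x / hval m q x)].

Variables (m : nat) (p q : {poly C}) (f : option C -> option C).
Hypotheses (m_gt1 : (1 < m)%N) (fP : ratmap m p q f).

Lemma ratmap_None x : f x = None <-> hval m q x = 0.
Proof. by case: fP => _ _ _ ->; case: eqP. Qed.

Lemma ratmap_Some x c : f x = Some c <-> hval m (p - c *: q) x = 0.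
Proof.
case: fP => _ _ nd ->; rewrite hvalB hvalZ; case: eqP => [q0|/eqP q0]; split=> //.
- by rewrite q0 mulr0 subr0 => /nd; rewrite q0 eqxx.
- by case=> <-; rewrite divfK ?subrr.
- by move/eqP; rewrite subr_eq0 => /eqP ->; rewrite mulfK.
Qed.

Lemma size_ratmap_eq c : (size (p - c *: q)%R <= m.+1)%N.
Proof.
case: fP => sp sq _ _; rewrite (leq_trans (size_polyD _ _)) // geq_max sp size_polyN.
exact: leq_trans (size_scale_leq _ _) sq.
Qed.

Lemma ratmap_surj y : exists x, f x = y.
Proof.
have m0 : (0 < m)%N by exact: ltnW.
case: y => [c|].
  by have [x hx] := hval_root m0 (size_ratmap_eq c); exists x; apply/ratmap_Some.
by case: fP => _ sq _ _; have [x hx] := hval_root m0 sq; exists x; apply/ratmap_None.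
Qed.

Lemma ratmap_eq_neq0 c : p - c *: q != 0.
Proof.
apply/eqP => e0; have [x fx] := ratmap_surj None.
have : f x = Some c by apply/ratmap_Some; rewrite e0 hval0.
by rewrite fx.
Qed.

Lemma ratmap_den_neq0 : q != 0.
Proof.
apply/eqP => q0; have [x fx] := ratmap_surj (Some 0).
by have : f x = None by [apply/ratmap_None; rewrite q0 hval0]; rewrite fx.
Qed.

Lemma ratmap_fiber y : exists2 s : seq (option C), (size s <= m.+1)%N &
  forall x, f x = y -> x \in s.
Proof.
case: y => [c|].
  have [s ss hs] := hval_zeros (ratmap_eq_neq0 c) (size_ratmap_eq c).
  by exists s => // x /ratmap_Some/hs.
case: fP => _ sq _ _; have [s ss hs] := hval_zeros ratmap_den_neq0 sq.
by exists s => // x /ratmap_None/hs.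
Qed.

Lemma ratmap_preim (s : seq (option C)) : exists2 s' : seq (option C),
  (size s' <= m.+1 * size s)%N & forall x, f x \in s -> x \in s'.
Proof.
elim: s => [|y s [s1 ss1 hs1]]; first by exists [::].
have [s2 ss2 hs2] := ratmap_fiber y; exists (s2 ++ s1).
  by rewrite size_cat /= mulnS leq_add.
by move=> x; rewrite inE mem_cat => /orP[/eqP/hs2 ->//|/hs1 ->]; rewrite orbT.
Qed.

Lemma ratmap_preim_iter k (s : seq (option C)) : exists2 s' : seq (option C),
  (size s' <= m.+1 ^ k * size s)%N & forall x, iter k f x \in s -> x \in s'.
Proof.
elim: k s => [|k IH] s; first by exists s; rewrite ?mul1n.
have [s1 ss1 hs1] := ratmap_preim s; have [s2 ss2 hs2] := IH s1.
exists s2 => [|x /hs1/hs2 //].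
by apply: leq_trans ss2 _; rewrite expnSr -mulnA leq_mul2l ss1 orbT.
Qed.

(** A finite point that is its own only preimage is totally ramified. *)
Lemma totally_ramified z : (forall x, f x = Some z -> x = Some z) ->
  exists2 c : C, c != 0 & p - z *: q = c *: ('X - z%:P) ^+ m.
Proof.
move=> tz; set r := p - z *: q.
have rm : r`_m != 0.
  by apply/eqP => rm; have: f None = Some z by [apply/ratmap_Some]; move/tz.
have sr : size r = m.+1.
  apply/eqP; rewrite eqn_leq size_ratmap_eq ltnNge; apply: contra_neqN rm => h.
  by rewrite nth_default.
have [rs ers] := closed_field_poly_normal r.
have lr : lead_coef r != 0 by rewrite lead_coef_eq0 ratmap_eq_neq0.
exists (lead_coef r) => //; rewrite [LHS]ers; congr (_ *: _).
have -> : rs = nseq m z.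
  have <- : size rs = m.
    by apply: succn_inj; rewrite -sr ers size_scale // size_prod_XsubC.
  apply/all_pred1P/allP => w wrs /=.
  suff [->] : Some w = Some z by [].
  apply: tz; apply/ratmap_Some; apply/eqP; rewrite -[_ == 0]/(root r w) ers rootZ //.
  by rewrite root_prod_XsubC.
by rewrite big_nseq iter_mulr_1.
Qed.

End RationalMaps.

(** * A fixed point with a second preimage *)

Section FixedPoints.
Variable C : numClosedFieldType.
Implicit Types (p q : {poly C}) (x y : option C) (n m : nat).

Lemma horner_deriv_exp_XsubC (k : nat) (c z w : C) :
  (c *: ('X - z%:P) ^+ k.+2)^`().[w] = c * (w - z) ^+ k.+1 *+ k.+2.
Proof.
rewrite derivZ deriv_exp derivXsubC mul1r /= hornerZ hornerMn horner_exp.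
by rewrite hornerXsubC mulrnAr.
Qed.

Lemma power_sum_eq_const (k : nat) (a b c z w : C) : b != 0 -> z != w ->
  a *: ('X - z%:P) ^+ k.+2 + b *: ('X - w%:P) ^+ k.+2 <> c%:P.
Proof.
move=> b0 zw /(congr1 (fun P : {poly C} => P^`().[z])) /eqP.
rewrite derivD hornerD !horner_deriv_exp_XsubC derivC horner0 subrr expr0n mulr0 mul0rn add0r.
by rewrite mulrn_eq0 mulf_eq0 (negPf b0) expf_eq0 subr_eq0 (negPf zw).
Qed.

(** The m-th powers of three linear polynomials X - z, X - w, X - u are not
    related by a relation with [b] nonzero, when m is at least 2: evaluating
    the relation and its derivative at [z] forces [b] to vanish. *)
Lemma power_sum3_neq0 (k : nat) (a b c z w u : C) : b != 0 -> z != w -> w != u ->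
  a *: ('X - z%:P) ^+ k.+2 + b *: ('X - w%:P) ^+ k.+2 + c *: ('X - u%:P) ^+ k.+2 != 0.
Proof.
move=> b0 zw wu; apply/eqP => P0.
move: (P0) => /(congr1 (fun P : {poly C} => P^`().[z])) /eqP.
rewrite !derivD !hornerD !horner_deriv_exp_XsubC deriv0 horner0 subrr expr0n mulr0 mul0rn add0r.
rewrite -mulrnDl mulrn_eq0 /= => /eqP e1.
move: P0 => /(congr1 (fun P : {poly C} => P.[z])).
rewrite !(hornerXsubC, hornerD, hornerZ, horner_exp) horner0 subrr expr0n mulr0 add0r => e2.
have : b * (z - w) ^+ k.+1 * (u - w) = 0.
  transitivity ((b * (z - w) ^+ k.+2 + c * (z - u) ^+ k.+2) -
     (z - u) * (b * (z - w) ^+ k.+1 + c * (z - u) ^+ k.+1)); last by rewrite e1 e2 mulr0 subr0.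
  by rewrite ![_ ^+ k.+2]exprS; ring.
move/eqP; rewrite !mulf_eq0 (negPf b0) expf_eq0 !subr_eq0 (negPf zw).
by rewrite eq_sym (negPf wu).
Qed.

(** Otherwise every fixed point is its own only preimage, hence totally ramified.
    If infinity is fixed then [f] is a polynomial, and two of its finite fixed
    points provide m-th powers with a constant linear combination.  If not, three
    finite fixed points provide linearly dependent m-th powers. *)
Lemma ratmap_fixpoint m p q (f : option C -> option C) : (1 < m)%N -> ratmap m p q f ->
  exists z0 w, [/\ f z0 = z0, f w = z0 & w != z0].
Proof.
move=> m1 fP; apply: contrapT => nex.
have H z0 : f z0 = z0 -> forall x, f x = z0 -> x = z0.
  move=> fz x fx; apply/eqP; apply: contrapT => /negP xz; apply: nex.
  by exists z0, x.
have {nex} tot z : f (Some z) = Some z ->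
    exists2 c : C, c != 0 & p - z *: q = c *: ('X - z%:P) ^+ m.
  by move=> fz; apply: (totally_ramified m1 fP) => x; exact: H.
have fixE z : (p - z *: q).[z] = 0 -> f (Some z) = Some z.
  by move=> e; apply/(ratmap_Some fP).
have [sp sq nd _] := fP.
case: m m1 fP tot sp sq nd => [//|[//|k]] _ fP tot sp sq nd.
have [fN|fN] := eqVneq (f None) None.
  (* [f] is a polynomial up to the constant [q], since infinity has no other
     preimage *)
  have q_root z : ~~ root q z.
    by apply/negP => /rootP/(ratmap_None fP (Some z))/(H _ fN).
  have [c0 c00 qE] : exists2 c0, c0 != 0 & q = c0%:P.
    have : size q = 1.
      apply/eqP; apply: contrapT => /negP/closed_rootP[z rz].
      by move: (q_root z); rewrite rz.
    by move/eqP/size_poly1P.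
  have qm : q`_k.+2 = 0 := (ratmap_None fP None).1 fN.
  have pm : p`_k.+2 != 0.
    by apply/eqP => pm; move: (nd None pm); rewrite /= qm eqxx.
  have spE : size p = k.+3.
    apply/eqP; rewrite eqn_leq sp ltnNge; apply: contra_neqN pm => h.
    by rewrite nth_default.
  have sXq : (size ('X * q)%R <= 2)%N.
    by rewrite qE mulrC mul_polyC (leq_trans (size_scale_leq _ _)) ?size_polyX.
  have [z1 /rootP rz1] : exists z, root (p - 'X * q) z.
    apply/closed_rootP; rewrite size_polyDl ?spE // size_polyN.
    exact: leq_ltn_trans sXq _.
  have fz1 : f (Some z1) = Some z1.
    by apply: fixE; rewrite -rz1 !hornerE.
  have [c c_neq0 pE] := tot _ fz1.
  (* the fixed points other than [z1] are the roots of p - X q divided by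
     X - z1 *)
  have [z2 /rootP rz2] : exists z, root (c *: ('X - z1%:P) ^+ k.+1 - q) z.
    apply/closed_rootP; rewrite size_polyDl size_scale // size_exp_XsubC //.
    by rewrite size_polyN qE (leq_ltn_trans (size_polyC_leq1 _)).
  have z12 : z1 != z2.
    apply: contraTneq (q_root z2) => e; rewrite negbK; apply/rootP.
    move: rz2; rewrite -e hornerD hornerN hornerZ horner_exp hornerXsubC subrr.
    by rewrite expr0n mulr0 add0r => /eqP; rewrite oppr_eq0 => /eqP.
  have fz2 : f (Some z2) = Some z2.
    apply: fixE.
    have -> : p - z2 *: q = c *: ('X - z1%:P) ^+ k.+2 - (z2 - z1) *: q.
      by rewrite -pE scalerBl opprB addrA subrK.
    rewrite hornerD hornerN !hornerZ exprS hornerM.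
    move: rz2; rewrite hornerD hornerN hornerZ => /eqP; rewrite subr_eq0 => /eqP <-.
    by rewrite hornerXsubC mulrCA subrr.
  have [c2 c2_neq0 pE2] := tot _ fz2.
  apply: (@power_sum_eq_const k c (- c2) ((z2 - z1) * c0) z1 z2) => //.
    by rewrite oppr_eq0.
  rewrite scaleNr -pE -pE2 qE polyCM -!mul_polyC polyCB; ring.
have qm : q`_k.+2 != 0.
  by apply: contra_neq fN => e; apply/(ratmap_None fP).
have sqE : size q = k.+3.
  apply/eqP; rewrite eqn_leq sq ltnNge; apply: contra_neqN qm => h.
  by rewrite nth_default.
have q0 : q != 0 by rewrite -size_poly_eq0 sqE.
have [z0 /rootP rz0] : exists z, root (p - 'X * q) z.
  apply/closed_rootP; rewrite addrC size_polyDl size_polyN mulrC size_mulX // sqE //.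
have fz0 : f (Some z0) = Some z0 by apply: fixE; rewrite -rz0 !hornerE.
have [c c_neq0 pE] := tot _ fz0.
have nrq z1 : f (Some z1) = Some z1 -> q.[z1] != 0.
  by move=> fz; apply/eqP => /(ratmap_None fP (Some z1)); rewrite fz.
(* this polynomial is the quotient of p - X q by X - z0 *)
have [z1 /rootP rz1] : exists z, root (c *: ('X - z0%:P) ^+ k.+1 - q) z.
  apply/closed_rootP; rewrite addrC size_polyDl size_polyN ?sqE // size_scale //.
  by rewrite size_exp_XsubC.
have z01 : z0 != z1.
  apply: contraTneq (nrq _ fz0) => e; rewrite negbK; apply/eqP.
  move: rz1; rewrite -e hornerD hornerN hornerZ horner_exp hornerXsubC subrr.
  by rewrite expr0n mulr0 add0r => /eqP; rewrite oppr_eq0 => /eqP.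
have fz1 : f (Some z1) = Some z1.
  apply: fixE.
  have -> : p - z1 *: q = c *: ('X - z0%:P) ^+ k.+2 - (z1 - z0) *: q.
    by rewrite -pE scalerBl opprB addrA subrK.
  rewrite hornerD hornerN !hornerZ exprS hornerM.
  move: rz1; rewrite hornerD hornerN hornerZ => /eqP; rewrite subr_eq0 => /eqP <-.
  by rewrite hornerXsubC mulrCA subrr.
have [c1 c1_neq0 pE1] := tot _ fz1.
have qE : (z1 - z0) *: q = c *: ('X - z0%:P) ^+ k.+2 - c1 *: ('X - z1%:P) ^+ k.+2.
  by rewrite -pE -pE1 scalerBl opprB [RHS]addrC addrA subrK.
have c1c : c1 != c.
  move/(congr1 (fun P : {poly C} => P`_k.+2)): qE.
  have XsubC_top z : (('X - z%:P) ^+ k.+2)`_k.+2 = 1.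
    have /monicP := monic_exp k.+2 (monicXsubC z).
    by rewrite lead_coefE size_exp_XsubC.
  rewrite coefB !coefZ !XsubC_top !mulr1 => e; apply/eqP => cc; move/eqP: e.
  by rewrite cc subrr mulf_eq0 (negPf qm) subr_eq0 eq_sym (negPf z01).
(* up to a constant, this is p - X q divided by X - z0 and by X - z1; it is not
   constant because its leading coefficient is c1 - c *)
have [z2 /rootP rz2] : exists z, root (c1 *: ('X - z1%:P) ^+ k.+1 - c *: ('X - z0%:P) ^+ k.+1) z.
  apply/closed_rootP; set P := (P in size P).
  suff : P`_k.+1 != 0 by apply: contra_neqN => /eqP s1; rewrite nth_default ?s1.
  have XsubC_top z : (('X - z%:P) ^+ k.+1)`_k.+1 = 1.
    have /monicP := monic_exp k.+1 (monicXsubC z).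
    by rewrite lead_coefE size_exp_XsubC.
  by rewrite coefB !coefZ !XsubC_top !mulr1 subr_eq0.
have rz2' : c1 * (z2 - z1) ^+ k.+1 = c * (z2 - z0) ^+ k.+1.
  by apply/eqP; rewrite -subr_eq0 -[X in _ == X]rz2 !hornerE.
have z12 : z1 != z2.
  apply/eqP => e; move/eqP: rz2'; rewrite -e subrr expr0n mulr0 eq_sym mulf_eq0.
  by rewrite (negPf c_neq0) expf_eq0 subr_eq0 eq_sym (negPf z01).
have fz2 : f (Some z2) = Some z2.
  apply: fixE; apply: (mulfI (_ : z1 - z0 != 0)); first by rewrite subr_eq0 eq_sym.
  rewrite mulr0 -hornerZ.
  have -> : (z1 - z0) *: (p - z2 *: q) =
      (z1 - z0) *: (p - z0 *: q) - (z2 - z0) *: ((z1 - z0) *: q).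
    by rewrite !scalerBr !scalerA -!mul_polyC ?polyCB ?polyCM ?polyCB; ring.
  rewrite pE qE !(hornerXsubC, hornerD, hornerN, hornerZ, horner_exp) ![_ ^+ k.+2]exprS.
  transitivity ((z2 - z0) * (z2 - z1) * (c1 * (z2 - z1) ^+ k.+1 - c * (z2 - z0) ^+ k.+1)).
    by ring.
  by rewrite rz2' subrr mulr0.
have [c2 c2_neq0 pE2] := tot _ fz2.
have b_neq0 : (z2 - z0) * c1 != 0.
  rewrite mulf_neq0 // subr_eq0; apply/eqP => e; move/eqP: rz2'.
  rewrite e subrr expr0n mulr0 mulf_eq0 (negPf c1_neq0) expf_eq0 subr_eq0.
  by rewrite (negPf z01).
have /eqP[] := power_sum3_neq0 k ((z1 - z2) * c) ((z0 - z1) * c2) b_neq0 z01 z12.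
rewrite -!scalerA -pE -pE1 -pE2 -!mul_polyC !polyCB; ring.
Qed.

End FixedPoints.

(** * Backward orbits and preperiodic points *)

Section Orbits.
Variable C : numClosedFieldType.
Variables (m : nat) (p q : {poly C}) (f : option C -> option C).
Hypotheses (m_gt1 : (1 < m)%N) (fP : ratmap m p q f).
Implicit Types (x y z : option C) (k l : nat).

(** Adjoining to a section of [f] over the k-th preimages the second preimage of
    [z0] yields one more point at each step. *)
Lemma ratmap_backward_orbit k : exists z0, f z0 = z0 /\
  exists2 s : seq (option C), uniq s /\ size s = k.+1 &
    forall x, x \in s -> iter k f x = z0.
Proof.
have [z0 [w [fz fw wz]]] := ratmap_fixpoint m_gt1 fP.
exists z0; split=> //.
have [pre preE] := choice (ratmap_surj m_gt1 fP).
(* the section [pre] modified so that [z0] lifts to itself *)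
pose pre' x := if x == z0 then z0 else pre x.
have pre'K x : f (pre' x) = x by rewrite /pre'; case: eqP => [->|].
suff [s [us ss zs hs]] : exists s, [/\ uniq s, size s = k.+1, z0 \in s &
    forall x, x \in s -> iter k f x = z0] by exists s.
elim: k => [|k [s [us ss zs hs]]].
  by exists [:: z0]; split=> // [|x]; rewrite inE // => /eqP.
exists (w :: map pre' s); split.
- rewrite /= (map_inj_uniq (can_inj pre'K)) us andbT; apply/mapP => -[x _ wx].
  by move: wz; rewrite wx -[x]pre'K -wx fw /pre' eqxx eqxx.
- by rewrite /= size_map ss.
- by rewrite inE; apply/orP; right; apply/mapP; exists z0; rewrite // /pre' eqxx.
move=> x; rewrite inE iterSr => /orP[/eqP ->|/mapP[y /hs ys ->]]; last by rewrite pre'K.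
by rewrite fw hs.
Qed.

(** Numerator and denominator of the k-th iterate of [f], as obtained by formal
    substitution into the homogenisations of [p] and [q]. *)
Fixpoint iter_num_den k : {poly C} * {poly C} :=
  if k is k'.+1 then
    let: (u, v) := iter_num_den k' in
    (\sum_(i < m.+1) p`_i *: (u ^+ i * v ^+ (m - i)),
     \sum_(i < m.+1) q`_i *: (u ^+ i * v ^+ (m - i)))
  else ('X, 1).

Lemma size_iter_num_den k :
  (size (iter_num_den k).1 <= (m ^ k).+1)%N /\ (size (iter_num_den k).2 <= (m ^ k).+1)%N.
Proof.
elim: k => [|k]; first by rewrite /= size_polyX size_poly1.
rewrite /=; case: (iter_num_den k) => u v /= [su sv].
have sX (i n : nat) (r : {poly C}) : (size r <= n.+1)%N -> (size (r ^+ i)%R <= (n * i).+1)%N.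
  move=> sr; apply: leq_trans (size_poly_exp_leq _ _) _.
  by rewrite ltnS leq_mul2r -subn1 leq_subLR add1n sr orbT.
suff H (r : {poly C}) :
    (size (\sum_(i < m.+1) r`_i *: (u ^+ i * v ^+ (m - i)))%R <= (m ^ k.+1).+1)%N by split.
apply: leq_trans (size_sum _ _ _) _; apply/bigmax_leqP => i _.
apply: leq_trans (size_scale_leq _ _) _; apply: leq_trans (size_polyMleq _ _) _.
have := leq_add (sX i _ _ su) (sX (m - i)%N _ _ sv).
rewrite addSn addnS -mulnDr subnKC; last by rewrite -ltnS.
by rewrite -expnSr; case: (_ + _)%N.
Qed.

(** The formal numerator and denominator have no common zero, hence they compute
    the iterates of [f] at finite points. *)
Lemma iter_num_denP k (z : C) :
  let: (u, v) := iter_num_den k in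
  (u.[z] != 0) || (v.[z] != 0) /\
  iter k f (Some z) = if v.[z] == 0 then None else Some (u.[z] / v.[z]).
Proof.
have [sp sq nd fE] := fP.
elim: k => [|k] /=; first by rewrite !hornerE oner_eq0 orbT divr1.
case: (iter_num_den k) => u v [uv ->].
have hE (r : {poly C}) : (size r <= m.+1)%N ->
    (\sum_(i < m.+1) r`_i *: (u ^+ i * v ^+ (m - i))).[z] =
    (if v.[z] == 0 then u.[z] else v.[z]) ^+ m *
    hval m r (if v.[z] == 0 then None else Some (u.[z] / v.[z])).
  move=> sr; rewrite horner_sum; case: eqP => [v0|/eqP v0] /=.
    rewrite (bigD1 ord_max) //= big1 => [|i /negP ni].
      by rewrite hornerZ hornerM !horner_exp subnn addr0 expr0 mulr1 mulrC.
    rewrite hornerZ hornerM !horner_exp v0 expr0n subn_eq0.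
    case: leqP => [le_mi|_]; last by rewrite !mulr0.
    by case: ni; apply/eqP/val_inj/eqP; rewrite eqn_leq le_mi -ltnS ltn_ord.
  rewrite (horner_coef_wide _ sr) mulr_sumr; apply: eq_bigr => i _.
  rewrite hornerZ hornerM !horner_exp expr_div_n [RHS]mulrCA; congr (_ * _).
  have im : (i <= m)%N by rewrite -ltnS.
  have -> : v.[z] ^+ m = v.[z] ^+ (m - i) * v.[z] ^+ i by rewrite -exprD subnK.
  by rewrite -mulrA (mulrC (v.[z] ^+ i)) divfK ?expf_neq0 // mulrC.
rewrite !hE //; set x := if _ then None else _.
set a := (if _ then _ else _) ^+ m.
have a0 : a != 0.
  by rewrite expf_neq0 //; case: (eqVneq v.[z] 0) uv => //= _; rewrite orbF.
rewrite fE !mulf_eq0 (negPf a0) /=; split; last by rewrite invfM mulrACA divff ?mul1r.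
by case: (eqVneq (hval m p x) 0) => [/nd ->|].
Qed.

(** Two distinct finite points with the same second iterate [z0] cannot both be
    fixed by an iterate of [f]. *)
Lemma ratmap_iter_not_id k : (0 < k)%N -> exists z : C, iter k f (Some z) <> Some z.
Proof.
move=> k0; apply: contrapT => /forallNP nex.
have id_k (z : C) n : iter (k * n) f (Some z) = Some z.
  elim: n => [|n IH]; first by rewrite muln0.
  by rewrite mulnS addnC iterD; have /contrapT -> := nex z.
have [z0 [fz [s [us ss] hs]]] := ratmap_backward_orbit 2.
have fixz n : iter n f z0 = z0 by elim: n => //= n ->.
have all_z0 (z : C) : Some z \in s -> Some z = z0.
  move=> /hs h; rewrite -(id_k z 2) -(@subnK 2 (k * 2)) ?iterD ?h //.
  by rewrite leq_pmull.
have : (size s <= size [:: None; z0])%N.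
  apply: uniq_leq_size => // -[z /all_z0 ->|_]; by rewrite !inE eqxx ?orbT.
by rewrite ss.
Qed.

(** The finite solutions of f^k(x) = x are the roots of u - X v, where u / v is
    the k-th iterate. *)
Lemma ratmap_periodic k : (0 < k)%N -> exists2 s : seq (option C),
  (size s <= (m ^ k).+3)%N & forall x, iter k f x = x -> x \in s.
Proof.
move=> k0; have [su sv] := size_iter_num_den k.
have uvP := iter_num_denP k.
case: (iter_num_den _) su sv uvP => u v /= su sv uvP.
pose D := u - 'X * v.
have DP (z : C) : D.[z] = 0 <-> iter k f (Some z) = Some z.
  have [uv ->] := uvP z; rewrite /D !hornerE; case: (eqVneq v.[z] 0) uv => [->|v0 _] /=.
    by rewrite orbF mulr0 subr0 => /eqP.
  split=> [/eqP|[e]]; last by rewrite -{2}e divfK ?subrr.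
  by rewrite subr_eq0 => /eqP ->; rewrite mulfK.
have D0 : D != 0.
  apply/eqP => D0; have [z] := ratmap_iter_not_id k0; apply.
  by apply/DP; rewrite D0 horner0.
have sD : (size D <= (m ^ k).+2)%N.
  rewrite (leq_trans (size_polyD _ _)) // geq_max (leqW su) size_polyN mulrC.
  by have [->|v0] := eqVneq v 0; rewrite ?mul0r ?size_poly0 // size_mulX.
have [s ss hs] := hval_zeros D0 sD.
exists (None :: s) => // -[z|]; last by rewrite inE.
by move=> /DP fz; rewrite inE hs ?orbT.
Qed.

Lemma ratmap_preperiodic k l : (0 < l)%N -> exists2 s : seq (option C),
  (size s <= m.+1 ^ k * (m ^ l).+3)%N &
  forall x, iter l f (iter k f x) = iter k f x -> x \in s.
Proof.
move=> l0; have [s ss hs] := ratmap_periodic l0.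
have [s' ss' hs'] := ratmap_preim_iter m_gt1 fP k s.
exists s' => [|x /hs/hs'//].
by apply: leq_trans ss' _; rewrite leq_mul2l ss orbT.
Qed.

End Orbits.

(** An orbit contained in a set of [n] elements is periodic from its n-th term on,
    with a period that is at most [n] and so divides n!. *)
Lemma iter_finite_orbit (T : eqType) (g : T -> T) (s : seq T) n (y : T) :
  (size s <= n)%N -> (forall i, iter i g y \in s) ->
  iter n`! g (iter n g y) = iter n g y.
Proof.
move=> sn hs.
have [i [j [ij jn eij]]] : exists i j, [/\ (i < j)%N, (j <= n)%N & iter i g y = iter j g y].
  apply: contrapT => nex.
  have u : uniq [seq iter i g y | i <- iota 0 n.+1].
    rewrite map_inj_in_uniq ?iota_uniq // => a b.
    rewrite !mem_iota /= add0n !ltnS => an bn e.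
    by case: (ltngtP a b) => // ab; case: nex; [exists a, b|exists b, a].
  have := uniq_leq_size u; rewrite size_map size_iota.
  have /[swap]/[apply] : {subset [seq iter i g y | i <- iota 0 n.+1] <= s}.
    by move=> x /mapP[i _ ->].
  by move=> /leq_trans/(_ sn); rewrite ltnn.
have per : iter (j - i) g (iter n g y) = iter n g y.
  rewrite -iterD; have -> : (j - i + n = (n - i) + j)%N by rewrite addnBAC ?addnBA; lia.
  by rewrite iterD -eij -iterD subnK //; lia.
have /dvdnP[k ->] : (j - i %| n`!)%N by apply: dvdn_fact; lia.
by elim: k => // k IH; rewrite mulSn iterD IH.
Qed.

(** * Bihomogeneous forms and elimination *)

Section Forms.
Local Open Scope classical_set_scope.
Variable C : numClosedFieldType.
Implicit Types (f g h : {poly {poly C}}) (x y : option C) (a e : nat).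

(** A form of bidegree (a, e) on the product of two projective lines is
    represented by its dehomogenisation, an element of C[X][Y] of degree at most
    [a] in the inner variable X and at most [e] in the outer variable Y. *)
Definition bideg_le a e f : Prop :=
  (size f <= e.+1)%N /\ forall j, (size (f`_j)%R <= a.+1)%N.

(** The restriction of the form [f] of bidegree (a, e) to the vertical line over
    [x], a binary form of degree [e]. *)
Definition fib a e f x : {poly C} := \poly_(j < e.+1) hval a f`_j x.

(** The value of the form [f] at the normalised coordinates of (x, y). *)
Definition hev a e f x y : C := hval e (fib a e f x) y.

(** The zero locus of the form [f] of bidegree (a, e). *)
Definition zform a e f : set (option C * option C) :=
  [set u | hev a e f u.1 u.2 = 0].

Lemma size_fib a e f x : (size (fib a e f x) <= e.+1)%N.
Proof. exact: size_poly. Qed.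

Lemma coef_fib a e f x j : bideg_le a e f -> (fib a e f x)`_j = hval a f`_j x.
Proof.
case=> sf _; rewrite coef_poly; case: ltnP => // ej.
by rewrite nth_default ?hval0 // (leq_trans sf).
Qed.

Lemma bideg_le0 a e : bideg_le a e 0.
Proof. by split=> [|j]; rewrite ?coef0 size_poly0. Qed.

Lemma bideg_leD a e f g : bideg_le a e f -> bideg_le a e g -> bideg_le a e (f + g).
Proof.
move=> [sf cf] [sg cg]; split=> [|j].
  by rewrite (leq_trans (size_polyD _ _)) // geq_max sf sg.
by rewrite coefD (leq_trans (size_polyD _ _)) // geq_max cf cg.
Qed.

Lemma bideg_leN a e f : bideg_le a e f -> bideg_le a e (- f).
Proof. by move=> [sf cf]; split=> [|j]; rewrite ?coefN size_polyN. Qed.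

Lemma bideg_le_sum a e (I : Type) (r : seq I) (P : pred I) (F : I -> {poly {poly C}}) :
  (forall i, P i -> bideg_le a e (F i)) -> bideg_le a e (\sum_(i <- r | P i) F i).
Proof.
by move=> H; apply: big_ind => //; [exact: bideg_le0|exact: bideg_leD].
Qed.

Lemma size_polyM_leq n m (R : comNzRingType) (p q : {poly R}) :
  (size p <= n.+1)%N -> (size q <= m.+1)%N -> (size (p * q)%R <= (n + m).+1)%N.
Proof.
move=> sp sq; rewrite (leq_trans (size_polyMleq _ _)) //.
by have := leq_add sp sq; rewrite addSn addnS; case: (_ + _)%N.
Qed.

Lemma bideg_leM a e a' e' f g : bideg_le a e f -> bideg_le a' e' g ->
  bideg_le (a + a') (e + e') (f * g).
Proof.
move=> [sf cf] [sg cg]; split=> [|j]; first exact: size_polyM_leq.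
rewrite coefM (leq_trans (size_sum _ _ _)) //; apply/bigmax_leqP => i _.
exact: size_polyM_leq.
Qed.

Lemma fibM a e a' e' f g x : bideg_le a e f -> bideg_le a' e' g ->
  fib (a + a') (e + e') (f * g) x = fib a e f x * fib a' e' g x.
Proof.
move=> bf bg; apply/polyP => j; rewrite (coef_fib _ _ (bideg_leM bf bg)) !coefM hval_sum.
apply: eq_bigr => i _; rewrite hvalM; first by rewrite !coef_fib.
  by case: bf => _; apply.
by case: bg => _; apply.
Qed.

Lemma hevM a e a' e' f g x y : bideg_le a e f -> bideg_le a' e' g ->
  hev (a + a') (e + e') (f * g) x y = hev a e f x y * hev a' e' g x y.
Proof. by move=> bf bg; rewrite /hev fibM // hvalM // size_fib. Qed.

Lemma fibD a e f g x : fib a e (f + g) x = fib a e f x + fib a e g x.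
Proof.
by apply/polyP => j; rewrite coefD !coef_poly coefD hvalD; case: ifP; rewrite ?addr0.
Qed.

Lemma hev0 a e x y : hev a e 0 x y = 0.
Proof.
rewrite /hev (_ : fib a e 0 x = 0) ?hval0 //.
by apply/polyP => j; rewrite coef_poly !coef0 hval0 if_same.
Qed.

Lemma hevD a e f g x y : hev a e (f + g) x y = hev a e f x y + hev a e g x y.
Proof. by rewrite /hev fibD hvalD. Qed.

Lemma hevZ a e (c : C) f x y : hev a e (c%:P%:P * f) x y = c * hev a e f x y.
Proof.
rewrite /hev -hvalZ; congr hval; apply/polyP => j.
by rewrite coefZ !coef_poly coefCM mul_polyC hvalZ; case: ifP; rewrite ?mulr0.
Qed.

Lemma hevB a e f g x y : hev a e (f - g) x y = hev a e f x y - hev a e g x y.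
Proof.
have -> : f - g = f + (-1)%:P%:P * g by rewrite !polyCN !polyC1 mulN1r.
by rewrite hevD hevZ mulN1r.
Qed.

Lemma hev_sum a e (I : Type) (r : seq I) (P : pred I) (F : I -> {poly {poly C}}) x y :
  hev a e (\sum_(i <- r | P i) F i) x y = \sum_(i <- r | P i) hev a e (F i) x y.
Proof.
by apply: (big_morph (fun f => hev a e f x y)); [move=> ? ?; exact: hevD|exact: hev0].
Qed.

Lemma zformM a e a' e' f g : bideg_le a e f -> bideg_le a' e' g ->
  zform (a + a') (e + e') (f * g) = zform a e f `|` zform a' e' g.
Proof.
move=> bf bg; apply/seteqP; split=> [[x y]|[x y]]; rewrite /zform /= hevM //.
  by move/eqP; rewrite mulf_eq0 => /orP[/eqP|/eqP]; [left|right].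
by case=> ->; rewrite ?mul0r ?mulr0.
Qed.

(** A form of degree [n] in the first variable that vanishes identically on more
    than [n] vertical lines is zero. *)
Lemma form_eq0 n e h (zs : seq C) : bideg_le n e h -> uniq zs -> (n < size zs)%N ->
  (forall z, z \in zs -> fib n e h (Some z) = 0) -> h = 0.
Proof.
move=> bh uz nz hz; apply/polyP => j; rewrite coef0; case: (bh) => _ /(_ j) sh.
apply/eqP; apply: contraT => h0; move: nz; rewrite ltnNge -ltnS.
rewrite (leq_trans _ sh) // max_poly_roots //.
apply/allP => z /hz /(congr1 (fun P : {poly C} => P`_j)).
by rewrite (coef_fib _ _ bh) coef0 => /rootP.
Qed.

(** A binary form of degree [k] is zero if it vanishes at [y] and at [k] finite
    points distinct from [y] and from each other; they are taken to be the
    translates of [y], or of 0 when [y] is infinite, by 1, ..., k. *)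
Lemma hval_eq0 (k : nat) (p : {poly C}) y : (size p <= k.+1)%N -> hval k p y = 0 ->
  (forall i, (i < k)%N -> p.[odflt 0 y + i.+1%:R] = 0) -> p = 0.
Proof.
move=> sp py hp; pose c := odflt 0 y.
have us : uniq [seq c + i.+1%:R | i <- iota 0 k].
  rewrite map_inj_uniq ?iota_uniq // => i j /addrI /eqP.
  by rewrite eqr_nat => /eqP[].
have sroot : all (root p) [seq c + i.+1%:R | i <- iota 0 k].
  by apply/allP => _ /mapP[i + ->]; rewrite mem_iota => ik; apply/rootP; rewrite hp.
apply/eqP; apply: contraT => p0; case: y @c us sroot py {hp} => [z|] /= us sroot py.
  have : (size (z :: [seq (z + i.+1%:R)%R | i <- iota 0 k]) < size p)%N.
    apply: max_poly_roots => //=; first by rewrite sroot andbT; apply/rootP.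
    rewrite us andbT; apply/mapP => -[i _ /eqP].
    by rewrite -subr_eq0 opprD addNKr oppr_eq0 pnatr_eq0.
  by rewrite /= size_map size_iota ltnNge sp.
have := max_poly_roots p0 sroot us.
by rewrite size_map size_iota ltnNge (size_leS_top sp py).
Qed.

(** A homogeneous linear system with more unknowns than equations has a nonzero
    solution. *)
Lemma underdetermined (K : fieldType) (I J : finType) (G : I -> J -> K) :
  (#|J| < #|I|)%N ->
  exists2 c : I -> K, exists i, c i != 0 & forall j, \sum_i c i * G i j = 0.
Proof.
move=> JI; pose A := \matrix_(i < #|I|, j < #|J|) G (enum_val i) (enum_val j).
have kA : kermx A != 0.
  rewrite -mxrank_eq0 mxrank_ker subn_eq0 -ltnNge.
  exact: leq_ltn_trans (rank_leq_col A) JI.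
have /sub_kermxP vA : (nz_row (kermx A) <= kermx A)%MS by exact: nz_row_sub.
move: kA; rewrite -nz_row_eq0; set v := nz_row _ in vA * => /rV0Pn[i vi].
exists (fun t => v 0 (enum_rank t)); first by exists (enum_val i); rewrite enum_valK.
move=> j; move/rowP: vA => /(_ (enum_rank j)); rewrite !mxE => vj; rewrite -[RHS]vj.
rewrite (reindex_onto enum_rank enum_val) /=; last by move=> *; rewrite enum_valK.
apply: eq_big => [t|t _]; first by rewrite enum_rankK eqxx.
by rewrite mxE !enum_rankK.
Qed.

(** The monomial X^i Y^j. *)
Definition XYmono (i j : nat) : {poly {poly C}} := ('X^i)%:P * 'X^j.

Lemma coef_XYmono i j i' j' : (XYmono i j)`_j'`_i' = ((i' == i) && (j' == j))%:R.
Proof.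
by rewrite coefCM coefXn; case: (j' == j); rewrite ?mulr1 ?mulr0 ?coef0 ?andbF ?coefXn ?andbT.
Qed.

Lemma bideg_le_XYmono a e i j (c : C) : (i <= a)%N -> (j <= e)%N ->
  bideg_le a e (c%:P%:P * XYmono i j).
Proof.
move=> ia je; split=> [|k].
  rewrite mulrA -polyCM mul_polyC (leq_trans (size_scale_leq _ _)) //.
  by rewrite size_polyXn.
rewrite coefCM mul_polyC (leq_trans (size_scale_leq _ _)) //.
apply/leq_sizeP => l al; rewrite coef_XYmono; case: eqP => // li.
by move: al; rewrite li ltnNge ia.
Qed.

(** The form of bidegree (a, e) with coefficients [c]. *)
Definition form_of_coefs (a e : nat) (c : 'I_a.+1 * 'I_e.+1 -> C) : {poly {poly C}} :=
  \sum_t (c t)%:P%:P * XYmono t.1 t.2.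

Lemma bideg_le_form_of_coefs a e c : bideg_le a e (@form_of_coefs a e c).
Proof. by apply: bideg_le_sum => -[i j] _; apply: bideg_le_XYmono; rewrite -ltnS ltn_ord. Qed.

Lemma coef_form_of_coefs a e c (t : 'I_a.+1 * 'I_e.+1) :
  (@form_of_coefs a e c)`_(t.2 : nat)`_(t.1 : nat) = c t.
Proof.
rewrite !coef_sum (bigD1 t) //= big1 => [|s st].
  by rewrite coefCM mul_polyC coefZ coef_XYmono !eqxx mulr1 addr0.
rewrite coefCM mul_polyC coefZ coef_XYmono; case: eqP => [e1|]; last by rewrite mulr0.
case: eqP => [e2|]; last by rewrite mulr0.
case/eqP: st; case: s t e1 e2 => [s1 s2] [t1 t2] /= e1 e2.
by congr (_, _); apply: val_inj.
Qed.

(** Elimination of one degree in the second variable.  Put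
    n = a (d2+1) + d1 (e+1) and k = d2 + e + 1.  For unknown S and T the form
    S V - T F has bidegree (n, k), and it vanishes at one point of the line over
    each chosen z.  Asking that it vanish at k more points on each of n+1 of
    these lines makes it zero.  This is (n+1) k equations for
    (n+1)(k+1) - n unknown coefficients. *)
Lemma elimination a e d1 d2 V F (zs : seq C) : V != 0 ->
  bideg_le a e.+1 V -> bideg_le d1 d2.+1 F ->
  uniq zs -> (a * d2.+1 + d1 * e.+1 < size zs)%N ->
  (forall z, z \in zs ->
     exists y, hev a e.+1 V (Some z) y = 0 /\ hev d1 d2.+1 F (Some z) y = 0) ->
  exists S T : {poly {poly C}}, [/\ T != 0, bideg_le (a * d2 + d1 * e.+1) d2 S,
     bideg_le (a * d2.+1 + d1 * e) e T & S * V = T * F].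
Proof.
move=> V0 bV bF uz sz cz.
set s1 := (a * d2 + d1 * e.+1)%N; set t1 := (a * d2.+1 + d1 * e)%N.
set n := (a * d2.+1 + d1 * e.+1)%N in sz; pose k := (d2 + e.+1)%N.
have s1E : (s1 + a = n)%N by rewrite /s1 /n; lia.
have t1E : (t1 + d1 = n)%N by rewrite /t1 /n; lia.
have kE : (e + d2.+1 = k)%N by rewrite /k; lia.
have [yz yzP] : exists yz : C -> option C, forall z, z \in zs ->
    hev a e.+1 V (Some z) (yz z) = 0 /\ hev d1 d2.+1 F (Some z) (yz z) = 0.
  have /choice[yz yzP] : forall z, exists y, z \in zs ->
    hev a e.+1 V (Some z) y = 0 /\ hev d1 d2.+1 F (Some z) y = 0.
    move=> z; have [/cz[y yP]|zn] := boolP (z \in zs); first by exists y.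
    by exists None.
  by exists yz.
pose I := (('I_s1.+1 * 'I_d2.+1) + ('I_t1.+1 * 'I_e.+1))%type.
pose J := ('I_n.+1 * 'I_k)%type.
pose G (t : I) : {poly {poly C}} :=
  match t with inl u => XYmono u.1 u.2 * V | inr u => - (XYmono u.1 u.2 * F) end.
pose pt (i : 'I_n.+1) := nth 0 zs i.
have ptz i : pt i \in zs by rewrite mem_nth // (leq_trans (ltn_ord i)).
have [c [t ct] hc] : exists2 c : I -> C, exists i, c i != 0 & forall j : J, \sum_i c i *
    hev n k (G i) (Some (pt j.1)) (Some (odflt 0 (yz (pt j.1)) + j.2.+1%:R)) = 0.
  apply: underdetermined; rewrite card_sum !card_prod !card_ord /k.
  by rewrite /s1 /t1 /n; nia.
pose S := form_of_coefs (fun u => c (inl u)); pose T := form_of_coefs (fun u => c (inr u)).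
have bS : bideg_le s1 d2 S by exact: bideg_le_form_of_coefs.
have bT : bideg_le t1 e T by exact: bideg_le_form_of_coefs.
have hE : S * V - T * F = \sum_i (c i)%:P%:P * G i.
  rewrite big_sumType /= !mulr_suml -sumrN; congr (_ + _); apply: eq_bigr => u _.
    by rewrite [RHS]mulrA.
  by rewrite mulrN [in RHS]mulrA.
have bSV : bideg_le n k (S * V) by rewrite -s1E; exact: bideg_leM.
have bTF : bideg_le n k (T * F) by rewrite -t1E -kE; exact: bideg_leM.
have h0 : S * V - T * F = 0.
  have bh : bideg_le n k (S * V - T * F) by apply: bideg_leD => //; exact: bideg_leN.
  apply: (form_eq0 bh (zs := [seq pt i | i : 'I_n.+1])).
  - rewrite map_inj_uniq ?enum_uniq // => i j /eqP.
    by rewrite nth_uniq ?(leq_trans (ltn_ord _)) // => /eqP/val_inj.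
  - by rewrite size_image card_ord.
  move=> _ /mapP[i _ ->]; have [Vy Fy] := yzP _ (ptz i).
  apply: (hval_eq0 (size_fib _ _ _ _) (y := yz (pt i))) => [|j jk].
    rewrite -/(hev _ _ _ _ _) hevB -{1}s1E -t1E -{2}kE !hevM //.
    by rewrite Vy Fy !mulr0 subrr.
  rewrite -[RHS](hc (i, Ordinal jk)).
  rewrite -[LHS]/(hev n k _ (Some (pt i)) (Some _)) hE hev_sum.
  by apply: eq_bigr => u _; rewrite hevZ.
have SVTF : S * V = T * F by apply/eqP; rewrite -subr_eq0 h0.
exists S, T; split=> //; apply/eqP => T0.
(* if T were zero then so would be S V, and all the coefficients [c] *)
have S0 : S = 0.
  by apply/eqP; move/eqP: SVTF; rewrite T0 mul0r mulf_eq0 (negPf V0) orbF.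
case/eqP: ct; case: t => u.
  by rewrite -(coef_form_of_coefs (fun u => c (inl u)) u) -/S S0 !coef0.
by rewrite -(coef_form_of_coefs (fun u => c (inr u)) u) -/T T0 !coef0.
Qed.

End Forms.

(** * Curves projecting onto the first factor *)

Section Curves.
Local Open Scope classical_set_scope.
Variable C : numClosedFieldType.
Implicit Types (f g h : {poly {poly C}}) (x y : option C) (a e : nat).
Implicit Types (X : set (option C * option C)).

(** Irreducibility tested on zero loci of single forms. *)
Definition form_irreducible X : Prop := forall a e f a' e' g,
  bideg_le a e f -> bideg_le a' e' g -> X `<=` zform a e f `|` zform a' e' g ->
  X `<=` zform a e f \/ X `<=` zform a' e' g.

(** [X] projects onto the whole first factor. *)
Definition dominant X : Prop := forall x, exists y, X (x, y).

(** A number of vertical lines which is sufficient for the descent from a form of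
    bidegree (a, e) to degree 0 in the second variable by eliminations against a
    form of bidegree (d1, d2). *)
Fixpoint contact d1 d2 e a : nat :=
  if e is e'.+1 then maxn (a * d2 + d1 * e).+1 (contact d1 d2 e' (a * d2 + d1 * e'))
  else 0.

(** Descending induction on [e]: [elimination] replaces V by a form T of degree
    e - 1 in the second variable, unless [X] is already in the zero locus of [F]. *)
Lemma subset_zform X d1 d2 F e a V (zs : seq C) :
  form_irreducible X -> dominant X -> bideg_le d1 d2.+1 F ->
  V != 0 -> bideg_le a e V -> X `<=` zform a e V ->
  uniq zs -> (contact d1 d2.+1 e a <= size zs)%N ->
  (forall z, z \in zs -> exists2 y, X (Some z, y) & zform d1 d2.+1 F (Some z, y)) ->
  X `<=` zform d1 d2.+1 F.
Proof.
move=> iX dX bF V0 bV XV uz + hz; elim: e a V V0 bV XV => [|e IH] a V V0 bV XV.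
  (* a form in the first variable alone cannot vanish on a dominant [X] *)
  move=> _; exfalso; case/negP: V0; apply/eqP.
  apply: (form_eq0 bV (zs := [seq i%:R | i <- iota 0 a.+1])).
  - rewrite map_inj_uniq ?iota_uniq // => i j /eqP.
    by rewrite eqr_nat => /eqP.
  - by rewrite size_map size_iota.
  move=> z _; have [y /XV] := dX (Some z); rewrite /zform /= /hev => h.
  apply/eqP; rewrite -size_poly_leq0; apply: size_leS_top; first exact: size_fib.
  move: h; case: y => [w|//] /=; rewrite [X in X.[w]]size1_polyC ?size_fib //.
  by rewrite hornerC.
rewrite /= geq_max => /andP[s1 s2].
have [|S [T [T0 bS bT ST]]] := elimination V0 bV bF uz s1.
  by move=> z /hz[y /XV Xy Fy]; exists y.
have XT : X `<=` zform (a * d2.+1 + d1 * e) e T `|` zform d1 d2.+1 F.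
  rewrite -zformM // -ST => u /XV Vu.
  have -> : (a * d2.+1 + d1 * e + d1 = (a * d2 + d1 * e.+1) + a)%N by lia.
  have -> : (e + d2.+1 = d2 + e.+1)%N by lia.
  by rewrite zformM //; right.
have [XT'|//] := iX _ _ _ _ _ _ bT bF XT.
exact: IH T0 bT XT' s2.
Qed.

(** A form vanishing identically on the vertical line over [x0] is divisible by
    the equation [l] of this line.  At infinity [l] is the constant 1, seen as a
    form of degree 1 in the first variable. *)
Lemma fib_eq0_factor a e f x0 : bideg_le a.+1 e f -> fib a.+1 e f x0 = 0 ->
  exists (l : {poly C}) g, [/\ (size l <= 2)%N, bideg_le a e g, f = l%:P * g &
    forall x, hval 1 l x = 0 -> x = x0].
Proof.
move=> bf f0; have [sf cf] := bf.
have c0 j : hval a.+1 f`_j x0 = 0 by rewrite -(coef_fib _ _ bf) f0 coef0.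
case: x0 {f0} c0 => [z|] c0.
  exists ('X - z%:P), (\poly_(j < e.+1) (f`_j %/ ('X - z%:P))); split.
  - by rewrite size_XsubC.
  - split=> [|j]; first exact: size_poly.
    rewrite coef_poly; case: ifP => _; last by rewrite size_poly0.
    rewrite size_divp ?polyXsubC_eq0 // size_XsubC /= leq_subLR add1n.
    exact: cf.
  - apply/polyP => j; rewrite coefCM coef_poly; case: ltnP => ej.
      by rewrite mulrC divpK // dvdp_XsubCl; apply/rootP/c0.
    by rewrite mulr0 nth_default // (leq_trans sf).
  case=> [w|] /=; first by rewrite hornerXsubC => /eqP; rewrite subr_eq0 => /eqP ->.
  by move/eqP; rewrite coefB coefX coefC subr0 oner_eq0.
exists 1, f; split; [by rewrite size_poly1| |by rewrite polyC1 mul1r|].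
  by split=> // j; apply: size_leS_top; [exact: cf|exact: c0].
by case=> // w /eqP; rewrite /= hornerC oner_eq0.
Qed.

(** Equations of the vertical line over [x0] can be removed from [f], because the
    irreducible dominant [X] is not contained in this line. *)
Lemma form_fib_neq0 X a e f x0 : form_irreducible X -> dominant X ->
  f != 0 -> bideg_le a e f -> X `<=` zform a e f ->
  exists a' g, [/\ bideg_le a' e g, X `<=` zform a' e g & fib a' e g x0 != 0].
Proof.
move=> iX dX; elim: a f => [|a IH] f f0 bf Xf.
  exists 0%N, f; split=> //; apply: contra_neq f0 => ff; apply/polyP => j.
  move/(congr1 (fun P : {poly C} => P`_j)): ff; rewrite (coef_fib _ _ bf) !coef0.
  have /size1_polyC -> : (size (f`_j)%R <= 1)%N by case: bf => _; apply.
  by case: x0 => [z|]; rewrite /= ?hornerC ?coefC /= => ->.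
have [ff|ff] := eqVneq (fib a.+1 e f x0) 0; last by exists a.+1, f.
have [l [g [sl bg fE lx]]] := fib_eq0_factor bf ff.
have bl : bideg_le 1 0 l%:P.
  split=> [|j]; first exact: size_polyC_leq1.
  by rewrite coefC; case: ifP; rewrite ?size_poly0.
have /iX : X `<=` zform 1 0 l%:P `|` zform a e g by rewrite -zformM // add1n -fE.
case/(_ bl bg) => [Xl|Xg]; last first.
  by apply: IH bg Xg; apply: contra_neq f0 => g0; rewrite fE g0 mulr0.
have X0 x y : X (x, y) -> x = x0.
  move/Xl; rewrite /zform /= /hev => h; apply: lx; rewrite -h.
  have -> : fib 1 0 l%:P x = (hval 1 l x)%:P.
    by apply/polyP => -[|j]; rewrite (coef_fib _ _ bl) !coefC ?hval0.
  by case: y {h} => [w|] /=; rewrite ?hornerC ?coefC.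
have [x1 x10] : exists x1, x1 <> x0 by clear; case: x0 => [z|]; [exists None|exists (Some 0)].
by have [y /X0] := dX x1.
Qed.

(** The fibre of [X] over any point has at most e+1 elements; the crude bound e+1
    instead of [e] allows for the point at infinity. *)
Lemma curve_fiber_finite X a e f x0 : form_irreducible X -> dominant X ->
  f != 0 -> bideg_le a e f -> X `<=` zform a e f ->
  exists2 s : seq (option C), (size s <= e.+1)%N & forall y, X (x0, y) -> y \in s.
Proof.
move=> iX dX f0 bf Xf.
have [a' [g [bg Xg gx]]] := form_fib_neq0 x0 iX dX f0 bf Xf.
have [s ss hs] := hval_zeros gx (size_fib _ _ _ _).
by exists s => // y /Xg/hs.
Qed.

Lemma zform_dominant a e f : (0 < e)%N -> dominant (zform a e f).
Proof. by move=> e0 x; apply: hval_root e0 (size_fib _ _ _ _). Qed.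

End Curves.

(** * Counting stable curves *)

Section InvariantCurves.
Local Open Scope classical_set_scope.
Variable C : numClosedFieldType.
Variables (m : nat) (p1 q1 p2 q2 : {poly C}) (f1 f2 : option C -> option C).
Hypotheses (m_gt1 : (1 < m)%N) (f1P : ratmap m p1 q1 f1) (f2P : ratmap m p2 q2 f2).
Variables (d1 d2 : nat).
Implicit Types (X : set (option C * option C)).

(** An irreducible zero locus of a nonzero form of bidegree (d1, d2+1), mapped
    into itself by the product of [f1] and [f2]. *)
Definition stable_curve X : Prop :=
  [/\ form_irreducible X, forall u, X u -> X (f1 u.1, f2 u.2) &
   exists f, [/\ f != 0, bideg_le d1 d2.+1 f & X = zform d1 d2.+1 f]].

(** A bound for the number of second coordinates that stable curves may have over
    the N-th preimages under [f1] of a well-chosen fixed point. *)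
Definition fiber_bound : nat :=
  let N := contact d1 d2.+1 d2.+1 d1 in
  (m.+1 ^ (d2.+2 + N) * (m ^ (d2.+2)`!).+3)%N.

(** The resulting bound for the number of stable curves of bidegree (d1, d2+1). *)
Definition curve_bound : nat := (fiber_bound.+1 ^ contact d1 d2.+1 d2.+1 d1)%N.

(** A stable curve is sent to the list of positions, in a fixed list of bounded
    length, of the second coordinates of chosen points of the curve over N fixed
    values of the first coordinate. *)
Lemma stable_curves_injection :
  exists Phi : set (option C * option C) ->
      {ffun 'I_(contact d1 d2.+1 d2.+1 d1) -> 'I_fiber_bound.+1},
  forall X Y, stable_curve X -> stable_curve Y -> Phi X = Phi Y -> X = Y.
Proof.
set N := contact _ _ _ _.
have [z0 [fz0 [s [us ss] hs]]] := ratmap_backward_orbit m_gt1 f1P N.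
(* of the N+1 preimages in [s] at most one is infinite *)
have [zs [uzs szs hzs]] : exists zs : seq C, [/\ uniq zs, size zs = N &
    forall z, z \in zs -> iter N f1 (Some z) = z0].
  pose zs := take N (pmap id s); exists zs.
  have spm : (N <= size (pmap id s))%N.
    have : (size s <= size (None :: map some (pmap id s)))%N.
      apply: uniq_leq_size => // -[z|_]; rewrite inE //= => zs'.
      by rewrite mem_map; [rewrite mem_pmap; apply/mapP; exists (Some z)|exact: Some_inj].
    by rewrite ss /= size_map.
  split; last 1 first.
  - move=> z /mem_take; rewrite mem_pmap => /mapP[x xs xz]; apply: hs.
    by rewrite xz.
  - by apply/take_uniq/(pmap_uniq (g := Some)) => // -[].
  - by rewrite size_takel.
(* fibres of stable curves over [z0] have at most d2+2 elements, whence the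
   preperiod d2+2 and the period (d2+2)! *)
have [E sE hE] := ratmap_preperiodic m_gt1 f2P (d2.+2 + N) (fact_gt0 d2.+2).
pose pick X z : option C := xget None [set y | X (Some z, y)].
have pickP X z : stable_curve X -> X (Some z, pick X z).
  move=> sX; have [y Xy] : exists y, X (Some z, y).
    by case: sX => _ _ [f [_ _ ->]]; exact: zform_dominant.
  exact: (xgetPex None (ex_intro [set y | X (Some z, y)] y Xy)).
(* the N-th iterate maps the point over [z] into the fibre over [z0], which is
   finite and stable under [f2] *)
have pickE X z : stable_curve X -> z \in zs -> pick X z \in E.
  move=> sX zz; have Xz := pickP X z sX; case: sX => iX fX [f [f0 bf XE]].
  have dX : dominant X by rewrite XE; exact: zform_dominant.
  have Xf : X `<=` zform d1 d2.+1 f by rewrite XE.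
  have [S sS hS] := curve_fiber_finite z0 iX dX f0 bf Xf.
  apply: hE; rewrite iterD; apply: (iter_finite_orbit sS) => i; apply: hS.
  have Xit n x y : X (x, y) -> X (iter n f1 x, iter n f2 y).
    by move=> Xxy; elim: n => [//|n /fX].
  have := Xit (i + N)%N _ _ Xz; rewrite !iterD (hzs _ zz).
  by have -> : iter i f1 z0 = z0 by elim: i => //= i ->.
exists (fun X => [ffun i : 'I_N => inord (index (pick X (nth 0 zs i)) E)]).
(* equal choices give common points, so each curve contains the other *)
suff half X Y : stable_curve X -> stable_curve Y ->
    (forall z, z \in zs -> pick X z = pick Y z) -> X `<=` Y.
  move=> X Y sX sY /ffunP XY.
  have XYz z : z \in zs -> pick X z = pick Y z.
    move=> zz; have iN : (index z zs < N)%N by rewrite -szs index_mem.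
    have := XY (Ordinal iN); rewrite !ffunE /= nth_index // => /(congr1 val) /=.
    rewrite !inordK ?ltnS ?(leq_trans (index_size _ _) sE) // => e.
    by rewrite -(nth_index None (pickE X z sX zz)) e nth_index // pickE.
  by apply/seteqP; split; apply: half => // z /XYz.
move=> sX sY XYz; have [iX _ [f [f0 bf XE]]] := sX; have [_ _ [g [g0 bg YE]]] := sY.
have dX : dominant X by rewrite XE; exact: zform_dominant.
have Xf : X `<=` zform d1 d2.+1 f by rewrite XE.
rewrite YE; apply: (subset_zform iX dX bg f0 bf Xf uzs); first by rewrite szs.
move=> z zz; exists (pick X z); first exact: pickP.
by rewrite -YE XYz //; exact: pickP.
Qed.

End InvariantCurves.

(** * Rational functions and multivariate forms *)

Section Translation.
Local Open Scope classical_set_scope.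
Variable R : realType.
Local Notation C := R[i].
Implicit Types (A : {fraction {poly C}}) (F : {mpoly C[2 + 2]}) (f : {poly {poly C}}).

(** The two definitions of the value at infinity agree: the coefficients of
    degree m of the numerator and the denominator give the limit of their
    quotient. *)
Lemma reval_ratmap (m : nat) (A : {fraction {poly C}}) : rdeg A = m ->
  ratmap m (rnum A) (rden A) (reval A).
Proof.
rewrite /rdeg => dA; set p := rnum A in dA *; set q := rden A in dA *.
have q0 : q != 0.
  rewrite /q /rden; have d0 := denom_ratioP (repr A).
  by rewrite divp_eq0 negb_or (negPf d0) /= gcdp_eq0 (negPf d0) andbF /=
    -leqNgt leq_gcdpr.
have cpq : coprimep p q.
  apply: coprimep_div_gcd; rewrite (denom_ratioP (repr A)) orbT.
  by [].
have rE x : reval A x = if x is Some z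
    then (if q.[z] == 0 then None else Some (p.[z] / q.[z]))
    else (if (size q < size p)%N then None else Some (p`_(size q).-1 / lead_coef q)).
  by [].
clearbody p q.
have sp : (size p <= m.+1)%N by rewrite -dA; lia.
have sq : (size q <= m.+1)%N by rewrite -dA; lia.
split=> //.
  case=> [z /= pz|/= pm]; first by apply: (coprimep_root cpq); apply/rootP.
  apply/eqP => qm; have sp' := size_leS_top sp pm; have sq' := size_leS_top sq qm.
  move: sp' sq' dA q0; rewrite -size_poly_gt0; move: (size p) (size q) => a b; lia.
case=> [z|]; rewrite rE //=; case: ltnP => spq.
  have -> : q`_m = 0 by rewrite nth_default //; move: dA spq; move: (size p) (size q) => a b; lia.
  by rewrite eqxx.
have -> : m = (size q).-1.
  by move: q0 dA spq; rewrite -size_poly_gt0; move: (size p) (size q) => a b; lia.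
by rewrite -lead_coefE lead_coef_eq0 (negPf q0).
Qed.

Lemma hcoord0 (x : P1 R) : hcoord x 0 0 = if x is Some z then z else 1.
Proof.
have -> : (0 : 'I_2) = lshift 1 (0 : 'I_1) by apply: val_inj.
by case: x => [z|]; rewrite [LHS]row_mxEl !mxE.
Qed.

Lemma hcoord1 (x : P1 R) : hcoord x 0 1 = if x is Some z then 1 else 0.
Proof.
have -> : (1 : 'I_2) = rshift 1 (0 : 'I_1) by apply: val_inj.
by case: x => [z|]; rewrite [LHS]row_mxEr !mxE.
Qed.

(** The homogeneous coordinates of the two factors, as variable indices. *)
Definition varX0 : 'I_(2 + 2) := lshift 2 (0 : 'I_2).
Definition varX1 : 'I_(2 + 2) := lshift 2 (1 : 'I_2).
Definition varY0 : 'I_(2 + 2) := rshift 2 (0 : 'I_2).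
Definition varY1 : 'I_(2 + 2) := rshift 2 (1 : 'I_2).

Lemma hcoord_monomial n i j (x : P1 R) : (i + j = n)%N ->
  hcoord x 0 0 ^+ i * hcoord x 0 1 ^+ j = hval n 'X^i x.
Proof.
rewrite hcoord0 hcoord1; case: x => [z|] <-.
  by rewrite expr1n mulr1 /= hornerXn.
rewrite expr1n mul1r expr0n /= coefXn; congr (_%:R); lia.
Qed.

Lemma prod_hcoord (u : P1 R * P1 R) (k : 'X_{1.. 2 + 2}) d1 d2 :
  (k varX0 + k varX1 = d1)%N -> (k varY0 + k varY1 = d2)%N ->
  \prod_i row_mx (hcoord u.1) (hcoord u.2) 0 i ^+ k i =
  hval d1 'X^(k varX0) u.1 * hval d2 'X^(k varY0) u.2.
Proof.
move=> e1 e2; rewrite big_split_ord /= !big_ord_recl !big_ord0 !mulr1.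
rewrite -(hcoord_monomial _ e1) -(hcoord_monomial _ e2) !row_mxEl !row_mxEr.
have -> : lift ord0 ord0 = 1 :> 'I_2 by apply: val_inj.
by [].
Qed.

Lemma hev_XYmono d1 d2 i j (c : C) (x y : option C) : (i <= d1)%N -> (j <= d2)%N ->
  hev d1 d2 (c%:P%:P * XYmono C i j) x y = c * (hval d1 'X^i x * hval d2 'X^j y).
Proof.
move=> id jd; rewrite hevZ; congr (_ * _); rewrite /hev -hvalZ; congr hval; apply/polyP => k.
rewrite coef_poly coefZ coefCM !coefXn.
case: eqP => [->|]; last by rewrite mulr0 hval0 if_same mulr0.
by rewrite ltnS jd !mulr1.
Qed.

Lemma sum_ord2 (G : 'I_2 -> nat) : (\sum_(i < 2) G i = G 0%R + G 1%R)%N.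
Proof. by rewrite !big_ord_recl big_ord0 addn0; congr (_ + G _)%N; apply: val_inj. Qed.

Lemma bihomogeneousE d1 d2 F k : bihomogeneous d1 d2 F -> k \in msupp F ->
  (k varX0 + k varX1 = d1)%N /\ (k varY0 + k varY1 = d2)%N.
Proof. by move=> bF /bF; rewrite !sum_ord2. Qed.

Lemma mnm4P (k l : 'X_{1.. 2 + 2}) :
  k varX0 = l varX0 -> k varX1 = l varX1 -> k varY0 = l varY0 -> k varY1 = l varY1 -> k = l.
Proof.
move=> e0 e1 e2 e3; apply/mnmP => i.
have H2 (j : 'I_2) : j = 0 \/ j = 1.
  by case: j => -[|[|//]] ?; [left|right]; apply: val_inj.
by case: (split_ordP i) => j ->; case: (H2 j) => ->.
Qed.

(** Dehomogenisation: the locus of a nonzero bihomogeneous polynomial is the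
    locus of a nonzero form. *)
Lemma form_of_mpoly d1 d2 F : bihomogeneous d1 d2 F -> F != 0 ->
  exists f, [/\ f != 0, bideg_le d1 d2 f & zero_locus F = zform d1 d2 f].
Proof.
move=> bF F0.
pose f : {poly {poly C}} := \sum_(k <- msupp F) (F@_k)%:P%:P * XYmono C (k varX0) (k varY0).
exists f; split.
- have [k kF] : exists k, k \in msupp F.
    by move: F0; rewrite -msupp_eq0; case: (msupp F) => // k s _; exists k; rewrite inE eqxx.
  have [k1 k2] := bihomogeneousE bF kF.
  apply/eqP => f0; move/eqP: (congr1 (fun g : {poly {poly C}} => g`_(k varY0)`_(k varX0)) f0).
  rewrite !coef0 !coef_sum (bigD1_seq k) ?msupp_uniq //= big_seq_cond big1 ?addr0.
    rewrite coefCM mul_polyC coefZ coef_XYmono !eqxx mulr1.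
    by move: kF; rewrite mcoeff_msupp => /negPf ->.
  move=> l /andP[lF lk]; have [l1 l2] := bihomogeneousE bF lF.
  rewrite coefCM mul_polyC coefZ coef_XYmono; case: eqP => [e1|]; last by rewrite mulr0.
  case: eqP => [e2|]; last by rewrite mulr0.
  by case/eqP: lk; apply: mnm4P => //; lia.
- rewrite /f big_seq; apply: bideg_le_sum => k kF.
  by have [k1 k2] := bihomogeneousE bF kF; apply: bideg_le_XYmono; lia.
suff e u : F.@[fun i => row_mx (hcoord u.1) (hcoord u.2) 0 i] = hev d1 d2 f u.1 u.2.
  by apply/seteqP; split=> u; rewrite /zero_locus /zform /= /vanishes_at e.
rewrite mevalE hev_sum big_seq [RHS]big_seq; apply: eq_bigr => k kF.
have [k1 k2] := bihomogeneousE bF kF.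
by rewrite hev_XYmono ?(prod_hcoord _ k1 k2) //; lia.
Qed.

Lemma form_of_coefsK a e f : bideg_le a e f ->
  f = form_of_coefs (fun t : 'I_a.+1 * 'I_e.+1 => f`_(t.2 : nat)`_(t.1 : nat)).
Proof.
move=> bf; set g := form_of_coefs _; have bg : bideg_le a e g by exact: bideg_le_form_of_coefs.
apply/polyP => j; apply/polyP => i; have [sf cf] := bf; have [sg cg] := bg.
have [je|ej] := ltnP j e.+1; last first.
  by rewrite (nth_default _ (leq_trans sf ej)) (nth_default _ (leq_trans sg ej)).
have [ia|ai] := ltnP i a.+1; last first.
  by rewrite (nth_default _ (leq_trans (cf j) ai)) (nth_default _ (leq_trans (cg j) ai)).
by have := coef_form_of_coefs (fun t : 'I_a.+1 * 'I_e.+1 => f`_(t.2 : nat)`_(t.1 : nat))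
  (Ordinal ia, Ordinal je).
Qed.

(** The exponent of the bihomogenisation to bidegree (a, e) of X^i Y^j. *)
Definition bihom_mnm (a e i j : nat) : 'X_{1.. 2 + 2} :=
  [multinom nth 0%N [:: i; a - i; j; e - j]%N t | t < 2 + 2].

Lemma bihom_mnmE a e i j : [/\ bihom_mnm a e i j varX0 = i, bihom_mnm a e i j varX1 = (a - i)%N,
  bihom_mnm a e i j varY0 = j & bihom_mnm a e i j varY1 = (e - j)%N].
Proof. by split; rewrite mnmE. Qed.

(** Bihomogenisation. *)
Lemma mpoly_of_form a e f : bideg_le a e f ->
  exists F, bihomogeneous a e F /\ zero_locus F = zform a e f.
Proof.
move=> bf; pose F : {mpoly C[2 + 2]} :=
  \sum_(t : 'I_a.+1 * 'I_e.+1) f`_(t.2 : nat)`_(t.1 : nat) *: 'X_[bihom_mnm a e t.1 t.2].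
exists F; split.
  move=> k kF; have [t <-] : exists t : 'I_a.+1 * 'I_e.+1, bihom_mnm a e t.1 t.2 = k.
    apply: contrapT => /forallNP nt; move: kF; rewrite mcoeff_msupp => /eqP; apply.
    rewrite raddf_sum /= big1 // => t _; rewrite mcoeffZ mcoeffX.
    by case: eqP => [/nt|_] //; rewrite mulr0.
  have [e0 e1 e2 e3] := bihom_mnmE a e t.1 t.2; rewrite !sum_ord2 e0 e1 e2 e3.
  have := ltn_ord t.1; have := ltn_ord t.2; lia.
suff E u : F.@[fun i => row_mx (hcoord u.1) (hcoord u.2) 0 i] = hev a e f u.1 u.2.
  by apply/seteqP; split=> u; rewrite /zero_locus /zform /= /vanishes_at E.
rewrite (form_of_coefsK bf) hev_sum raddf_sum; apply: eq_bigr => t _ /=.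
have t1 := ltn_ord t.1; have t2 := ltn_ord t.2.
have [e0 e1 e2 e3] := bihom_mnmE a e t.1 t.2.
rewrite mevalZ mevalX (@prod_hcoord _ _ a e) ?e0 ?e1 ?e2 ?e3; try lia.
by rewrite hev_XYmono.
Qed.

Lemma zform_closed a e f : bideg_le a e f -> zariski_closed (zform a e f).
Proof.
case/mpoly_of_form => F [bF <-]; exists [set F]; split.
  by move=> _ ->; exists a, e.
by apply/seteqP; split=> u; [move=> Fu _ -> //|exact].
Qed.

Lemma invariant_stable (A1 A2 : {fraction {poly C}}) d1 d2 (X : set (P1 R * P1 R)) :
  invariant_curves A1 A2 d1 d2.+1 X ->
  stable_curve (reval A1) (reval A2) d1 d2 X.
Proof.
move=> [[_ [_ iX] fX] [F [bF [F0 _] XF]]]; split.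
- move=> a e f a' e' g bf bg; apply: iX; exact: zform_closed.
- by move=> u Xu; rewrite -fX; exists u.
by have [f [f0 bf Ff]] := form_of_mpoly bF F0; exists f; rewrite XF.
Qed.

Lemma invariant_curves_inj (m : nat) (A1 A2 : {fraction {poly C}}) d1 d2 : (2 <= m)%N ->
  rdeg A1 = m -> rdeg A2 = m ->
  exists Phi : set (P1 R * P1 R) ->
      {ffun 'I_(contact d1 d2.+1 d2.+1 d1) -> 'I_(fiber_bound m d1 d2).+1},
    {in invariant_curves A1 A2 d1 d2.+1 &, injective Phi}.
Proof.
move=> m1 /reval_ratmap r1 /reval_ratmap r2.
have [Phi PhiI] := stable_curves_injection m1 r1 r2 d1 d2.
exists Phi => X Y; rewrite !inE => /invariant_stable sX /invariant_stable sY.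
exact: PhiI.
Qed.

End Translation.

Section InjectionIntoFinite.
Local Open Scope classical_set_scope.

Lemma finite_set_inj (T : choiceType) (U : finType) (A : set T) (Phi : T -> U) :
  {in A &, injective Phi} -> finite_set A.
Proof.
by move=> inj; rewrite -(eq_finite_set (inj_card_eq inj)); exact: finite_finset.
Qed.

Lemma card_fset_set_inj (T : choiceType) (U : finType) (A : set T) (Phi : T -> U) :
  {in A &, injective Phi} -> (#|` fset_set A| <= #|U|)%N.
Proof.
move=> inj; have fA := finite_set_inj inj.
have u : uniq [seq Phi x | x <- fset_set A].
  rewrite map_inj_in_uniq ?fset_uniq // => x y.
  by rewrite !in_fset_set //; exact: inj.
by rewrite cardE -(size_map Phi) uniq_leq_size // => x _; rewrite mem_enum.
Qed.

End InjectionIntoFinite.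

Theorem theorem6p10 (R : realType) :
  (forall (m : nat) (A1 A2 : {fraction {poly R[i]}}),
     (2 <= m)%N -> rdeg A1 = m -> rdeg A2 = m ->
     forall d1 d2 : nat, (0 < d1)%N -> (0 < d2)%N ->
     finite_set (invariant_curves A1 A2 d1 d2)) /\
  (exists gamma : nat -> nat -> nat -> R,
     forall (m : nat) (A1 A2 : {fraction {poly R[i]}}),
     (2 <= m)%N -> rdeg A1 = m -> rdeg A2 = m ->
     forall d1 d2 : nat, (0 < d1)%N -> (0 < d2)%N ->
     (#|` fset_set (invariant_curves A1 A2 d1 d2)|)%:R <= gamma m d1 d2).
Proof.
split=> [m A1 A2 m1 r1 r2 d1 [//|d2] _ _|].
  have [Phi PhiI] := invariant_curves_inj d1 d2 m1 r1 r2.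
  exact: finite_set_inj PhiI.
(* [curve_bound] counts curves of degree d2+1 in the second variable *)
exists (fun m d1 d2 => (curve_bound m d1 d2.-1)%:R).
move=> m A1 A2 m1 r1 r2 d1 [//|d2] _ _.
have [Phi PhiI] := invariant_curves_inj d1 d2 m1 r1 r2.
rewrite ler_nat (leq_trans (card_fset_set_inj PhiI)) //.
by rewrite card_ffun !card_ord.
Qed.
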